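(* Let $X$ be a real or complex Banach space and let $(x_i)\in S(\ell^1(X))$. Then $(x_i)$ is smooth in $\ell^1(X)$ if and only if $\|x_i\|\neq 0$ for all $i\in\mathbb{N}$ and $\frac{x_i}{\|x_i\|}$ is smooth in $X$ for each $i\in\mathbb{N}$.
   Context: $\ell^1(X)$ is the Banach space of sequences $(x_i)_{i\in\mathbb{N}}$ in $X$ with $\|(x_i)\|=\sum_{i}\|x_i\|<\infty$. For a Banach space $E$, $S(E)$ denotes its unit sphere. A point $e\in S(E)$ is smooth in $E$ if the state space $S_e=\{e^*\in S(E^* ):e^*(e)=1\}$ is a singleton. *)

(* Defs.v *)
From HB Require Import structures.
From mathcomp Require Import all_boot all_order all_algebra.
From mathcomp Require Import all_classical all_reals all_analysis.
From mathcomp Require Import complex.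

Set Implicit Arguments.
Unset Strict Implicit.
Unset Printing Implicit Defensive.

Import Order.TTheory GRing.Theory Num.Theory.
Import numFieldNormedType.Exports.

Local Open Scope classical_set_scope.
Local Open Scope ring_scope.

(* "Real or complex": [K : scalars R] is one of the two fields [R] and [R[i]].
   Norms of a [normedModType K] take their values in [K]; over [R[i]] the order
   is partial, and [0 <= z] means that [z] is real and nonnegative. *)
Variant scalars (R : realType) := RealScalars | ComplexScalars.

Definition scalar_field (R : realType) (K : scalars R) : numFieldType :=
  match K with
  | RealScalars => R : numFieldType
  | ComplexScalars => R[i] : numFieldType
  end.

Coercion scalar_field : scalars >-> Num.NumField.type.

Section smoothness.
Variables (K : numFieldType) (E : normedModType K).

Definition unit_sphere : set E := [set x | `|x| = 1].

(* The unit sphere of the dual: continuous linear functionals whose operator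
   norm, the supremum of |f x| over the closed unit ball, is 1. *)
Definition dual_unit_sphere : set {linear E -> K^o} :=
  [set f | continuous f /\
    supremums [set `|f x| | x in [set x : E | `|x| <= 1]] (1 : K)].

Definition state_space (e : E) : set {linear E -> K^o} :=
  [set f | dual_unit_sphere f /\ f e = 1].

Definition smooth (e : E) : Prop :=
  unit_sphere e /\ exists f, state_space e = [set f].

End smoothness.

Section order_limits.
Variable K : numFieldType.

Lemma num_cvg_ge0 (T : Type) (F : set_system T) (FF : ProperFilter F)
  (s : T -> K) (l : K) :
  s @ F --> l -> (\forall t \near F, 0 <= s t) -> 0 <= l.
Proof.
move=> sl s0; have H : `|s t| @[t --> F] --> `|l| by exact: cvg_norm.
have H' : `|s t| @[t --> F] --> l.
  apply: cvg_trans sl; apply: near_eq_cvg.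
  by near=> t; rewrite ger0_norm//; near: t.
have -> : l = `|l| by apply: (cvg_unique (@norm_hausdorff K K^o) H').
exact: normr_ge0.
Unshelve. all: by end_near. Qed.

Lemma num_cvg_le (T : Type) (F : set_system T) (FF : ProperFilter F)
  (s : T -> K) (l M : K) :
  s @ F --> l -> (\forall t \near F, s t <= M) -> l <= M.
Proof.
move=> sl sM; rewrite -subr_ge0.
apply: (@num_cvg_ge0 _ F FF (fun t => M - s t)).
  by apply: cvgB sl; exact: cvg_cst.
by near=> t; rewrite subr_ge0; near: t.
Unshelve. all: by end_near. Qed.

Lemma num_cvg_ge (T : Type) (F : set_system T) (FF : ProperFilter F)
  (s : T -> K) (l M : K) :
  s @ F --> l -> (\forall t \near F, M <= s t) -> M <= l.
Proof.
move=> sl sM; rewrite -subr_ge0.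
apply: (@num_cvg_ge0 _ F FF (fun t => s t - M)).
  by apply: cvgB => //; exact: cvg_cst.
by near=> t; rewrite subr_ge0; near: t.
Unshelve. all: by end_near. Qed.

Lemma num_is_cvgn (s : nat -> K) (l : K) :
  (forall e : K, 0 < e -> \forall n \near \oo, `|l - s n| < e) -> cvgn s.
Proof. by move=> sl; apply/cvg_ex; exists l; exact/cvgrPdist_lt. Qed.

End order_limits.

Lemma scalars_monotone_cvg (R : realType) (K : scalars R) (s : nat -> K)
  (M : K) : (forall n, 0 <= s n) -> nondecreasing_seq s ->
  (forall n, s n <= M) -> cvgn s.
Proof.
case: K s M => /= s M s0 ds sM.
  by apply: nondecreasing_is_cvgn => //; exists M => _ [n _ <-].
have sE n : s n = ((complex.Re (s n))%:C)%C.
  by move: (s0 n); case: (s n) => a b; rewrite lecE/= => /andP[/eqP -> _].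
pose r n := complex.Re (s n).
have dr : nondecreasing_seq r.
  by move=> m n /ds; rewrite lecE => /andP[].
have cr : cvgn r.
  apply: nondecreasing_is_cvgn => //; exists (complex.Re M) => _ [n _ <-].
  by have := sM n; rewrite lecE => /andP[].
apply: (@num_is_cvgn _ s ((limn r)%:C)%C) => e e0.
have eE : e = ((complex.Re e)%:C)%C.
  by move: (ltW e0); case: (e) => a b; rewrite lecE/= => /andP[/eqP -> _].
have re0 : 0 < complex.Re e by move: e0; rewrite {1}eE ltcR.
move/cvgrPdist_lt: cr => /(_ _ re0); apply: filterS => n.
by rewrite eE (sE n) -/(r n) -rmorphB normc_def/= expr0n/= addr0 sqrtr_sqr ltcR.
Qed.

Section l1.
Variables (R : realType) (K : scalars R).

Definition norm_summable (X : normedModType K) (x : nat -> X) : Prop :=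
  cvgn [series `|x i| : K]_i.

Definition l1_pred (X : normedModType K) : {pred nat -> X} :=
  [pred x | `[< norm_summable x >] ].

Section normed.
Variable X : normedModType K.
Implicit Types x y : nat -> X.

Let snondecr x : nondecreasing_seq [series `|x i| : K]_i.
Proof.
by apply/nondecreasing_seqP => n; rewrite /series/= big_nat_recr//= lerDl.
Qed.

Lemma norm_summable_bounded x (M : K) :
  (forall n, \sum_(0 <= i < n) `|x i| <= M) -> norm_summable x.
Proof.
move=> xM; apply: (@scalars_monotone_cvg _ _ _ M) => //.
by move=> n; rewrite /series/= sumr_ge0.
Qed.

Definition l1_sum x : K := limn [series `|x i| : K]_i.

Lemma l1_sum_ge x n : norm_summable x -> \sum_(0 <= i < n) `|x i| <= l1_sum x.
Proof.
move=> sx; apply: (num_cvg_ge _ sx).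
by exists n => // m /= nm; exact: snondecr.
Qed.

Lemma l1_sum_le x (M : K) : norm_summable x ->
  (forall n, \sum_(0 <= i < n) `|x i| <= M) -> l1_sum x <= M.
Proof.
move=> sx xM; apply: (num_cvg_le _ sx).
by near=> n; exact: xM.
Unshelve. all: by end_near. Qed.

Lemma l1_sumD_le x y n : norm_summable x -> norm_summable y ->
  \sum_(0 <= i < n) `|(x + y) i| <= l1_sum x + l1_sum y.
Proof.
move=> sx sy.
apply: le_trans (lerD (l1_sum_ge n sx) (l1_sum_ge n sy)).
by rewrite -big_split/=; apply: ler_sum => i _; exact: ler_normD.
Qed.

Lemma l1_sumZ_series (a : K) x :
  [series `|(a *: x) i| : K]_i = (`|a| : K) *: [series `|x i| : K]_i.
Proof.
apply/funext => n.
rewrite [RHS](_ : _ = `|a| * \sum_(0 <= i < n) `|x i|)// mulr_sumr /series/=.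
by apply: eq_bigr => i _; rewrite normrZ.
Qed.

Lemma norm_summableZ (a : K) x : norm_summable x -> norm_summable (a *: x).
Proof.
rewrite /norm_summable l1_sumZ_series => sx.
exact: (@is_cvgZr _ K^o _ _ _ _ _ sx).
Qed.

Lemma l1_submod_closed : submod_closed (@l1_pred X).
Proof.
split.
  apply/asboolP; apply: (@norm_summable_bounded _ 0) => n.
  by rewrite big1// => i _; rewrite normr0.
move=> a x y /asboolP sx /asboolP sy; apply/asboolP.
apply: (@norm_summable_bounded _ (l1_sum (a *: x) + l1_sum y)) => n.
by apply: l1_sumD_le => //; exact: norm_summableZ.
Qed.

End normed.

HB.instance Definition _ (X : normedModType K) :=
  GRing.isSubmodClosed.Build K (nat -> X) (@l1_pred X)
    (@l1_submod_closed X).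

Record l1 (X : normedModType K) := L1 {
  l1_seq :> nat -> X ;
  l1_summable : l1_seq \in @l1_pred X }.

Section l1_normed.
Variable X : normedModType K.

HB.instance Definition _ := [isSub for @l1_seq X].
HB.instance Definition _ := gen_eqMixin (l1 X).
HB.instance Definition _ := gen_choiceMixin (l1 X).
HB.instance Definition _ := [SubChoice_isSubLmodule of l1 X by <:].

Lemma l1_norm_summable (x : l1 X) : norm_summable x.
Proof. exact/asboolP/l1_summable. Qed.
Arguments l1_norm_summable : clear implicits.

Definition l1_norm (x : l1 X) : K := l1_sum x.

Let l1_normD (x y : l1 X) : l1_norm (x + y) <= l1_norm x + l1_norm y.
Proof.
apply: l1_sum_le; first exact: l1_norm_summable.
by move=> n; apply: l1_sumD_le; exact: l1_norm_summable.
Qed.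

Let l1_normZ (a : K) (x : l1 X) : l1_norm (a *: x) = `|a| * l1_norm x.
Proof.
rewrite /l1_norm /l1_sum l1_sumZ_series.
by rewrite (@limZr _ K^o)//; exact: l1_norm_summable.
Qed.

Let l1_norm_coord (x : l1 X) i : `|x i| <= l1_norm x.
Proof.
apply: le_trans (l1_sum_ge i.+1 (l1_norm_summable x)).
by rewrite big_nat_recr//= lerDr sumr_ge0.
Qed.

Let l1_norm_eq0 (x : l1 X) : l1_norm x = 0 -> x = 0.
Proof.
move=> x0; apply/val_inj/funext => i; apply/normr0_eq0/le_anti.
by rewrite normr_ge0 andbT -x0 l1_norm_coord.
Qed.

HB.instance Definition _ :=
  Lmodule_isNormed.Build K (l1 X) l1_normD l1_normZ l1_norm_eq0.

Lemma l1_normE (x : l1 X) : `|x| = limn [series `|x i| : K]_i.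
Proof. by []. Qed.

Lemma l1_coord_le (x : l1 X) i : `|x i| <= `|x|.
Proof. exact: l1_norm_coord. Qed.

End l1_normed.
Arguments l1_norm_summable {X} x : rename.

Section l1_complete.
Variable X : completeNormedModType K.

Lemma l1_complete (F : set_system (l1 X)) :
  ProperFilter F -> cauchy F -> cvg F.
Proof.
move=> FF /cauchy_ballP Fc.
have Fd (e : K) : 0 < e -> exists2 A, F A &
    forall x y, A x -> A y -> `|x - y| < e.
  move=> e0; have [[A B] /= [FA FB] AB] := Fc _ e0.
  exists (A `&` B); first exact: filterI.
  move=> x y [Ax _] [_ By].
  by have := AB (x, y) (conj Ax By); rewrite /= -ball_normE.
have cF i : cvg ((fun x : l1 X => x i) @ F).
  apply/cauchy_cvgP/cauchy_ballP => e e0.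
  have [A FA Ae] := Fd _ e0.
  have FB : F ((fun x : l1 X => x i) @^-1` [set x i | x in A]).
    by apply: filterS FA => x Ax; exists x.
  exists ([set x i | x in A], [set x i | x in A]) => //=.
  move=> [_ _] /= [[x Ax <-] [y Ay <-]]; rewrite -ball_normE /=.
  exact: le_lt_trans (l1_coord_le (x - y) i) (Ae _ _ Ax Ay).
pose y i := lim ((fun x : l1 X => x i) @ F).
have key (e : K) (A : set (l1 X)) (x : l1 X) n : F A -> (forall x y, A x -> A y -> `|x - y| < e) ->
    A x -> \sum_(0 <= i < n) `|x i - y i| <= e.
  move=> FA Ae Ax.
  have cs : (fun z : l1 X => \sum_(0 <= i < n) `|x i - z i| : K) @ F -->
      (\sum_(0 <= i < n) `|x i - y i| : K).
    apply: (@cvg_big K^o); first exact: add_continuous.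
    move=> i _; apply: cvg_norm; apply: cvgB; first exact: cvg_cst.
    exact: cF.
  apply: (num_cvg_le _ cs); apply: filterS FA => z Az /=.
  apply: le_trans (ltW (Ae _ _ Ax Az)).
  exact: (l1_sum_ge n (l1_norm_summable (x - z))).
have [A1 FA1 A1e] := Fd _ ltr01.
have [x1 A1x1] := filter_ex FA1.
have sy : norm_summable y.
  apply: (@norm_summable_bounded _ _ (l1_sum x1 + 1)) => n.
  apply: le_trans (lerD (l1_sum_ge n (l1_norm_summable x1))
    (key _ _ _ n FA1 A1e A1x1)).
  rewrite -big_split/=; apply: ler_sum => i _.
  by rewrite -{1}[y i](subKr (x1 i)) ler_normB.
have yP : y \in @l1_pred X by exact/asboolP.
apply/cvg_ex; exists (L1 yP).
apply/cvgrPdist_le => e e0; have [A FA Ae] := Fd _ e0.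
apply: filterS (FA) => x Ax; rewrite distrC.
apply: l1_sum_le; first exact: l1_norm_summable.
by move=> n; exact: (key _ _ _ n FA Ae Ax).
Qed.

HB.instance Definition _ := Uniform_isComplete.Build (l1 X) l1_complete.

End l1_complete.
End l1.
Arguments l1_norm_summable {R K X} x : rename.

(* Main.v *)
(* A functional f of norm at most 1 on l1(X) is the sum of its components
   f_i : X -> K, each of norm at most 1. It satisfies f(x) = 1 = sum |x_i| exactly
   when f_i(x_i) = |x_i| for every i, so the states of x are the families of
   contractions f_i with f_i(x_i) = |x_i|, chosen independently of each other.
   Such a family is unique iff each component is, and at an index with x_i = 0
   the component would be arbitrary. *)
Require Import Defs.
From HB Require Import structures.
From mathcomp Require Import all_boot all_order all_algebra.
From mathcomp Require Import all_classical all_reals all_analysis.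
From mathcomp Require Import complex.

Set Implicit Arguments.
Unset Strict Implicit.
Unset Printing Implicit Defensive.

Import Order.TTheory GRing.Theory Num.Theory.
Import numFieldNormedType.Exports.

Local Open Scope classical_set_scope.
Local Open Scope ring_scope.

(** * Linear functionals and state spaces *)

Lemma linear_ext {K : numFieldType} {E F : lmodType K} (f g : {linear E -> F}) :
  f =1 g -> f = g.
Proof.
case: f g => f [[[f0 fD]] [fZ]] [g [[[g0 gD]] [gZ]]] /= fg.
have E1 : f = g by exact/funext.
by subst g; congr GRing.Linear.Pack; congr GRing.Linear.Class;
  [congr Algebra.isNmodMorphism.Axioms_|congr GRing.isScalable.Axioms_];
  exact: Prop_irrelevance.
Qed.

(** Homogeneity extends the bound from the unit ball to all [y]. Conversely, the contraction bound
    gives continuity, and [f e = 1] makes the supremum 1 attained at [e]. *)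
Lemma state_spaceP {K : numFieldType} {E : normedModType K} {e : E}
    (f : {linear E -> K^o}) : unit_sphere e ->
  state_space e f <-> f e = 1 /\ (forall y, `|f y| <= `|y|).
Proof.
rewrite /unit_sphere/= => e1; split.
  move=> [[_ [ub _]] fe]; split=> // y.
  have [->|y0] := eqVneq y 0; first by rewrite linear0 !normr0.
  have ny : `|y| != 0 by rewrite normr_eq0.
  have : `|f (`|y|^-1 *: y)| <= (1 : K).
    apply: ub; exists (`|y|^-1 *: y) => //=.
    by rewrite normrZ normfV normr_id mulVf.
  rewrite linearZ normrZ normfV normr_id.
  by rewrite mulrC ler_pdivrMr ?normr_gt0// mul1r.
move=> [fe fle]; split=> //; split.
  apply/linear_bounded_continuous/linear_boundedP.
  near=> r => y; apply: le_trans (fle y) _.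
  by rewrite ler_peMl//; near: r; exact: nbhs_pinfty_ge.
split.
  by move=> _ [y /= y1 <-]; exact: le_trans (fle y) y1.
by move=> M; apply; exists e => /=; rewrite ?e1// fe normr1.
Unshelve. all: by end_near. Qed.

Lemma smooth_uniq {K : numFieldType} {E : normedModType K} {e : E} :
  smooth e -> forall f g, state_space e f -> state_space e g -> f = g.
Proof. by move=> [_ [h ->]] f g /= -> ->. Qed.

(** * Scalar series and the triangle inequality *)

Lemma series_cvg_abs {R : realType} {K : scalars R} (s t : nat -> K) :
  (forall n, `|s n| <= t n) -> cvgn (series t) -> cvgn (series s).
Proof.
have real_case (u : nat -> K) : (forall n, u n \is Num.real) ->
    (forall n, `|u n| <= t n) -> cvgn (series t) -> cvgn (series u).
  move=> ur ut ct.
  (* The terms of [u + t] lie between 0 and [2t], so monotone convergence applies to its series. *)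
  have -> : u = (u + t) - t by rewrite addrK.
  apply: is_cvg_seriesB => //.
  have ut0 n : 0 <= (u + t) n.
    rewrite -[X in _ <= X]/(u n + t n) -lerBlDl sub0r.
    by apply: le_trans (ut n); rewrite -normrN real_ler_norm// realN.
  have t0 n : 0 <= t n by exact: le_trans (ut n).
  have nd (v : nat -> K) : (forall n, 0 <= v n) -> nondecreasing_seq (series v).
    move=> v0; apply/nondecreasing_seqP => n.
    by rewrite /series/= big_nat_recr//= lerDl.
  apply: (@scalars_monotone_cvg _ _ _ (limn (series t) *+ 2)).
  - by move=> n; rewrite /series/= sumr_ge0.
  - exact: nd.
  - move=> n; apply: (@le_trans _ _ (series t n *+ 2)).
      rewrite /series/= -sumrMnl; apply: ler_sum => i _.
      rewrite -[X in X <= _]/(u i + t i) mulr2n lerD2r.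
      by apply: le_trans (ut i); rewrite real_ler_norm.
    rewrite lerMn2r/=; apply: (num_cvg_ge _ ct).
    by exists n => // m /= nm; exact: nd.
move=> st ct; case: K s t real_case st ct => /= s t real_case st ct.
  by apply: real_case => // n; exact: num_real.
have -> : s = (fun n => 'Re (s n)) + 'i *: (fun n => 'Im (s n)).
  by apply/funext => n; rewrite [LHS]Crect.
apply: is_cvg_seriesD; last apply: is_cvg_seriesZ.
- apply: real_case => // n.
  by apply: le_trans (st n); exact: leif_normC_Re_Creal.
- apply: real_case => // n; apply: le_trans (st n).
  rewrite -[`|s n|]mul1r -(normCi R[i]) -normrM.
  (* Multiplication by ['i] preserves the norm, so the bound on real parts also covers imaginary
     parts. *)
  have -> : 'Im (s n) = - 'Re ('i * s n) by rewrite ReMil opprK.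
  by rewrite normrN; exact: leif_normC_Re_Creal.
Qed.

(* Equality case of the triangle inequality for 1 = z + (1 - z). *)
Lemma norm_split_eq {R : realType} {K : scalars R} (a z : K) :
  `|z| <= a -> `|1 - z| <= 1 - a -> z = a.
Proof.
case: K a z => /= a z za z1a.
  apply/le_anti; rewrite (le_trans (ler_norm z) za)/=.
  by have := le_trans (ler_norm _) z1a; rewrite lerD2l lerN2.
(* With the reverse chain ['Re z <= |z| <= a] this forces ['Re z = |z|], which holds only for
   [z >= 0]. *)
have aRe : a <= 'Re z.
  have := le_trans (leif_Re_Creal _) z1a.
  by rewrite raddfB/= (Creal_ReP _ (rpred1 _)) lerD2l lerN2.
have zE : 'Re z = `|z|.
  by apply/le_anti; rewrite leif_Re_Creal/= (le_trans za).
have z0 : 0 <= z by have [_ <-] := leif_Re_Creal z; exact/eqP.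
by apply/le_anti; rewrite -{1}(ger0_norm z0) za/= -(ger0_norm z0) -zE.
Qed.

(** * Coordinate embeddings and components of functionals *)

Section l1_functionals.
Context {R : realType} {K : scalars R} {X : normedModType K}.
Implicit Types (x y : l1 X) (v : X) (f : {linear l1 X -> K^o}).

Lemma sum_norm_single (i n : nat) v :
  \sum_(0 <= j < n) `|if j == i then v else 0| <= `|v|.
Proof.
under eq_bigr do rewrite fun_if normr0.
by rewrite -big_mkcond big_nat1_eq; case: ifP.
Qed.

Lemma l1_single_summable (i : nat) v :
  (fun j => if j == i then v else 0) \in @l1_pred R K X.
Proof.
apply/asboolP/(@norm_summable_bounded _ _ _ _ `|v|) => n.
exact: sum_norm_single.
Qed.

(** The i-th component of a functional [f] is the composite [f \o l1_single i]. *)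
Definition l1_single (i : nat) v : l1 X := L1 (l1_single_summable i v).

Lemma l1_single_linear i : linear (l1_single i).
Proof.
move=> a u v; apply/val_inj/funext => j.
rewrite -[RHS]/(a *: l1_single i u j + l1_single i v j) /=.
by case: ifP; rewrite ?scaler0 ?addr0.
Qed.

HB.instance Definition _ i :=
  GRing.isLinear.Build K X (l1 X) *:%R (l1_single i) (l1_single_linear i).

Lemma l1_ext x y : (forall i, x i = y i) -> x = y.
Proof. by move=> xy; exact/val_inj/funext. Qed.

(** The norm is additive over disjoint supports; this is what makes the components of a contraction
    independent. *)
Lemma l1_norm_remove x i : `|x - l1_single i (x i)| + `|x i| <= `|x|.
Proof.
rewrite -lerBrDr; apply: l1_sum_le; first exact: l1_norm_summable.
move=> n; rewrite lerBrDr.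
(* Partial sums are lengthened to [n + i.+1] so that they contain the index [i]. *)
apply: le_trans (l1_sum_ge (n + i.+1) (l1_norm_summable x)).
have iI : (i < n + i.+1)%N by rewrite addnS ltnS leq_addl.
have coordE j : (x - l1_single i (x i)) j = if j == i then 0 else x j.
  rewrite -[LHS]/(x j - if j == i then x i else 0).
  by case: eqP => [->|_]; rewrite ?subrr ?subr0.
apply: (@le_trans _ _
    (\sum_(0 <= j < n + i.+1) `|(x - l1_single i (x i)) j| + `|x i|)).
  by rewrite lerD2r !big_mkord [leRHS]big_split_ord/= lerDl sumr_ge0.
under eq_bigr do rewrite coordE.
rewrite !big_mkord (bigD1 (Ordinal iI))//= [leRHS](bigD1 (Ordinal iI))//=.
rewrite eqxx normr0 add0r [leRHS]addrC lerD2r; apply: ler_sum => j.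
by rewrite -val_eqE => /= /negbTE ->.
Qed.

Lemma l1_norm_single i v : `|l1_single i v| <= `|v|.
Proof.
apply: l1_sum_le; first exact: l1_norm_summable.
by move=> n; exact: sum_norm_single.
Qed.

Section contraction.
Context {f : {linear l1 X -> K^o}}.
Hypothesis f1 : forall y, `|f y| <= `|y|.

Lemma contraction_single_le i v : `|f (l1_single i v)| <= `|v|.
Proof. exact: le_trans (f1 _) (l1_norm_single i v). Qed.

(* Deleting the first n coordinates of y one at a time leaves a remainder whose
   norm is the tail of the series defining |y|. *)
Lemma contraction_series y :
  series (fun i => f (l1_single i (y i)) : K) @ \oo --> (f y : K).
Proof.
have tail n : `|f y - \sum_(0 <= i < n) f (l1_single i (y i))| <=
    `|y| - \sum_(0 <= i < n) `|y i|.
  pose z m : l1 X := y - \sum_(0 <= i < m) l1_single i (y i).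
  have zn m : (forall i, (m <= i)%N -> z m i = y i) /\
      `|z m| <= `|y| - \sum_(0 <= i < m) `|y i|.
    elim: m => [|m [zE zle]].
      by rewrite /z !big_geq// !subr0; split.
    have zS : z m.+1 = z m - l1_single m (z m m).
      by rewrite (zE m (leqnn m)) /z big_nat_recr//= opprD addrA.
    split.
      move=> i mi; rewrite zS.
      rewrite -[LHS]/(z m i - if i == m then z m m else 0).
      by rewrite gtn_eqF// subr0 zE// ltnW.
    have := l1_norm_remove (z m) m; rewrite -zS (zE m (leqnn m)) => zle'.
    by rewrite big_nat_recr//= opprD addrA lerBrDr (le_trans zle').
  have [_ zle] := zn n; apply: le_trans zle.
  by rewrite -raddf_sum -raddfB f1.
apply/cvgrPdist_le => e e0.
have /cvgrPdist_le/(_ _ e0) := l1_norm_summable y.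
apply: filterS => n; apply: le_trans; apply: le_trans (tail n) _.
(* The order on [R[i]] is partial, so bounding a scalar by its norm requires it to be real. *)
apply: real_ler_norm; rewrite realB// ?normr_real// ger0_real ?sumr_ge0//.
Qed.

End contraction.

(** The functional obtained from [f] by exchanging its i-th component for [g]. *)
Definition replace_coord f i (g : {linear X -> K^o}) y : K^o :=
  f (y - l1_single i (y i)) + g (y i).

Lemma replace_coord_linear f i g : linear (replace_coord f i g).
Proof.
move=> a y z; rewrite /replace_coord -[(a *: y + z) i]/(a *: y i + z i).
have -> : a *: y + z - l1_single i (a *: y i + z i) =
    a *: (y - l1_single i (y i)) + (z - l1_single i (z i)).
  by rewrite linearP scalerBr opprD addrACA.
by rewrite !linearP scalerDr addrACA.
Qed.

HB.instance Definition _ f i g := GRing.isLinear.Build K (l1 X) K^o *:%R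
  (replace_coord f i g) (replace_coord_linear f i g).

End l1_functionals.

(** * States of [x] and states of its normalized coordinates *)

Section smooth_l1.
Context {R : realType} {K : scalars R} {X : normedModType K}.
Implicit Types (x y : l1 X) (f : {linear l1 X -> K^o}) (g : {linear X -> K^o}).

(** Put [z = f (l1_single i (x i))]. Then [1 - z] is the value of [f] at [x] without its i-th
    coordinate, of norm at most [1 - |x i|], so [norm_split_eq] applies. *)
Lemma state_coord x f i : unit_sphere x -> state_space x f ->
  f (l1_single i (x i)) = `|x i|.
Proof.
move=> x1 /(state_spaceP _ x1)[fx fle].
apply: norm_split_eq; first exact: contraction_single_le.
rewrite -{1}fx -raddfB; apply: le_trans (fle _) _.
by rewrite lerBrDr -[X in _ <= X](x1 : `|x| = 1) l1_norm_remove.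
Qed.

Lemma unit_sphere_normalize (E : normedModType K) (v : E) :
  `|v| != 0 -> unit_sphere (`|v|^-1 *: v).
Proof.
by move=> v0; rewrite /unit_sphere/= normrZ normfV normr_id mulVf.
Qed.

Lemma state_normalizeP (E : normedModType K) (v : E) (h : {linear E -> K^o}) :
  `|v| != 0 -> state_space (`|v|^-1 *: v) h <->
  h v = `|v| /\ (forall u, `|h u| <= `|u|).
Proof.
move=> v0; rewrite (state_spaceP h (unit_sphere_normalize v0)).
rewrite linearZ/=; split=> -[hv hle]; split=> //.
  by apply: (mulfI (invr_neq0 v0)); rewrite mulVf.
by rewrite hv; exact: mulVf.
Qed.

Lemma state_comp_single x f i : unit_sphere x -> `|x i| != 0 ->
  state_space x f -> state_space (`|x i|^-1 *: x i) (f \o l1_single i).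
Proof.
move=> x1 xi0 sf; apply/state_normalizeP => //; split.
  exact: state_coord.
by move=> v; have [_ fle] := (state_spaceP _ x1).1 sf; exact: contraction_single_le.
Qed.

(** By [state_coord] the old component also took the value [|x i|] at [x i], so the value at [x] is
    unchanged; [l1_norm_remove] gives the bound. *)
Lemma state_replace_coord x f g i : unit_sphere x -> state_space x f ->
  g (x i) = `|x i| -> (forall v, `|g v| <= `|v|) ->
  state_space x (replace_coord f i g).
Proof.
move=> x1 sf gx gle; have [fx fle] := (state_spaceP _ x1).1 sf.
apply/state_spaceP => //; split.
  by rewrite /= /replace_coord gx raddfB/= state_coord// fx subrK.
move=> y; apply: le_trans (l1_norm_remove y i).
by rewrite /= /replace_coord (le_trans (ler_normD _ _))// lerD.
Qed.

Lemma replace_coord_single f g i v : replace_coord f i g (l1_single i v) = g v.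
Proof. by rewrite /replace_coord /= eqxx subrr linear0 add0r. Qed.

(* If [x i = 0], the [i]-th component of a norming functional of [x] can be
   replaced both by 0 and by its [j]-th component, where [x j != 0]; no appeal
   to Hahn-Banach is needed. *)
Lemma smooth_l1_neq0 x i : smooth x -> `|x i| != 0.
Proof.
move=> sx; have [x1 [f fE]] := sx.
have sf : state_space x f by rewrite fE.
rewrite normr_eq0; apply/eqP => xi0.
have [j xj0] : exists j, x j != 0.
  apply: contrapT => /forallNP x0; have : (1 : K) = 0.
    rewrite -(x1 : `|x| = 1) (_ : x = 0) ?normr0//.
    by apply: l1_ext => j; apply/eqP/negP => /negP; exact: x0.
  by apply/eqP; rewrite oner_eq0.
have [fx fle] := (state_spaceP _ x1).1 sf.
(* Since [x i = 0], every contraction [g] is an admissible i-th component, and smoothness forces it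
   to equal that of [f]. *)
have coord_eq (g : {linear X -> K^o}) : (forall v, `|g v| <= `|v|) ->
    forall v, f (l1_single i v) = g v.
  move=> gle v; have <- : replace_coord f i g = f :> {linear _ -> _}.
    apply: (smooth_uniq sx) => //; apply: state_replace_coord => //.
    by rewrite xi0 linear0 normr0.
  exact: replace_coord_single.
have f0 v : f (l1_single i v) = 0.
  by apply: (coord_eq \0) => u; rewrite normr0.
have fj := coord_eq (f \o l1_single j) (contraction_single_le fle j).
move: (xj0); rewrite -normr_eq0 -(state_coord j x1 sf).
by rewrite -[f _]/((f \o l1_single j) (x j)) -fj f0 eqxx.
Qed.

(** A component of the state of [x] is a state of the coordinate. Any rival [g] can be transplanted
    into [f], giving a state of [x], hence [f] itself. *)
Lemma smooth_l1_coord x i : smooth x -> smooth (`|x i|^-1 *: x i).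
Proof.
move=> sx; have xi0 := smooth_l1_neq0 i sx; have [x1 [f fE]] := sx.
have sf : state_space x f by rewrite fE.
split; first exact: unit_sphere_normalize.
exists (f \o l1_single i); apply/seteqP; split=> [g|_ ->]; last first.
  exact: state_comp_single.
move=> /(state_normalizeP _ xi0)[gx gle]; apply: linear_ext => v /=.
have <- : replace_coord f i g = f :> {linear _ -> _}.
  by apply: (smooth_uniq sx) => //; exact: state_replace_coord.
exact/esym/replace_coord_single.
Qed.

(** The functional is [y |-> sum_i g_i(y_i)], whose series is dominated by that of [|y|]. *)
Lemma l1_pairing (g : nat -> {linear X -> K^o}) :
  (forall i v, `|g i v| <= `|v|) ->
  exists f, (forall y, `|f y| <= `|y|) /\ forall i v, f (l1_single i v) = g i v.
Proof.
move=> gle.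
have gs y : cvgn (series (fun i => g i (y i) : K)).
  by apply: (series_cvg_abs _ (l1_norm_summable y)) => i.
pose h y : K^o := limn (series (fun i => g i (y i) : K)).
have hlin : linear h.
  move=> a y z; rewrite /h.
  rewrite [X in limn (series X)](_ : _ =
      a *: (fun i => g i (y i) : K) + (fun i => g i (z i) : K)); last first.
    by apply/funext => i; rewrite -[X in g i X]/(a *: y i + z i) linearP.
  rewrite lim_seriesD//; last exact: is_cvg_seriesZ.
  by rewrite lim_seriesZ.
pose f : {linear l1 X -> K^o} :=
  HB.pack h (GRing.isLinear.Build K (l1 X) K^o *:%R h hlin).
exists f; split=> [y|i v].
  apply: (num_cvg_le _ (cvg_norm (gs y))); near=> n.
  rewrite /series/=; apply: le_trans (ler_norm_sum _ _ _) _.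
  apply: le_trans (l1_sum_ge n (l1_norm_summable y)).
  by apply: ler_sum => i _.
apply: cvg_lim => //.
(* From [n = i.+1] on, the partial sum includes the only nonzero term. *)
apply: cvg_near_cst; exists i.+1 => // n /= ni.
rewrite /series/=.
rewrite (eq_bigr (fun j => if j == i then g i v else 0)); last first.
  move=> j _; rewrite -[LHS]/(g j (if j == i then v else 0)).
  by case: eqP => [->|_]; rewrite ?linear0.
by rewrite -big_mkcond big_nat1_eq ni.
Unshelve. all: by end_near. Qed.

(** Summing components, [f x] is the series of the [|x i|], which is [|x| = 1]. *)
Lemma state_l1P x f : unit_sphere x -> (forall i, `|x i| != 0) ->
  (forall y, `|f y| <= `|y|) ->
  (forall i, state_space (`|x i|^-1 *: x i) (f \o l1_single i)) ->
  state_space x f.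
Proof.
move=> x1 x0 fle fs; apply/state_spaceP => //; split=> //.
have := @contraction_series _ _ _ f fle x.
have -> : (fun i => f (l1_single i (x i)) : K) = (fun i => `|x i|).
  by apply/funext => i; have /(state_normalizeP _ (x0 i))[] := fs i.
move=> sf; rewrite -(x1 : `|x| = 1).
exact: (cvg_unique (@norm_hausdorff K K^o) sf (l1_norm_summable x)).
Qed.

(** Both values are the limit of the same component series. *)
Lemma contraction_ext f1 f2 : (forall y, `|f1 y| <= `|y|) ->
  (forall y, `|f2 y| <= `|y|) ->
  (forall i v, f1 (l1_single i v) = f2 (l1_single i v)) -> f1 = f2.
Proof.
move=> f1le f2le f12; apply: linear_ext => y.
apply: (cvg_unique (@norm_hausdorff K K^o) (@contraction_series _ _ _ f1 f1le y)).
under [X in series X]eq_fun do rewrite f12.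
exact: contraction_series.
Qed.

(** The states [g i] of the coordinates are glued by [l1_pairing]. The components of any other state
    of [x] are again states of the coordinates, hence equal to the [g i]. *)
Lemma smooth_l1 x : unit_sphere x -> (forall i, `|x i| != 0) ->
  (forall i, smooth (`|x i|^-1 *: x i)) -> smooth x.
Proof.
move=> x1 x0 sx; split=> //.
have [g gE] := choice (fun i => (sx i).2).
have sg i : state_space (`|x i|^-1 *: x i) (g i) by rewrite gE.
have gle i v : `|g i v| <= `|v|.
  by have [_ ->] := (state_normalizeP _ (x0 i)).1 (sg i).
have [f [fle fg]] := l1_pairing gle.
have fgE i : f \o l1_single i = g i :> {linear _ -> _}.
  by apply: linear_ext => v; exact: fg.
exists f; apply/seteqP; split=> [h sh|_ ->] /=; last first.
  by apply: state_l1P => // i; rewrite fgE.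
have [_ hle] := (state_spaceP _ x1).1 sh.
apply: contraction_ext => // i v.
have hg : h \o l1_single i = g i :> {linear _ -> _}.
  by have := state_comp_single x1 (x0 i) sh; rewrite gE.
by rewrite fg -hg.
Qed.

End smooth_l1.

Theorem proposition2p10 (R : realType) (K : scalars R)
    (X : completeNormedModType K) (x : l1 X) :
  unit_sphere x ->
  smooth x <->
  (forall i : nat, `|x i| != 0) /\
  (forall i : nat, smooth (`|x i|^-1 *: x i)).
Proof.
move=> x1; split=> [sx|[x0 sx]]; last exact: smooth_l1.
by split=> i; [exact: smooth_l1_neq0|exact: smooth_l1_coord].
Qed.
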